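(* Let $G=(V,E)$ be a finite directed graph in which every vertex has an incoming edge and an outgoing edge, with $|E|\ge 2$. For every $n=0,1,2,\dots$ we have $d_n^G[e]=c_n^G[e]$ for all $e\in E$ and $d_n^G(u)=c_n^G(u)$ for all $u\in V$, so that $$d_n^G=c_n^G .$$
   Context: For $e\in E$ let $s(e),t(e)$ be its source and terminal vertex. Loops and multiple edges are allowed. Let $A^G(e,f)=1$ if $t(e)=s(f)$ and $0$ otherwise ($e,f\in E$). **$G$-Catalan numbers $c_n^G$.** $\mathcal{O}_{A^G}$ is the Cuntz-Krieger algebra: the universal $C^*$-algebra generated by partial isometries $S_e$, $e\in E$, with $\sum_{f\in E}S_fS_f^*=1$ and $S_e^*S_e=\sum_{f\in E}A^G(e,f)S_fS_f^*$. For $v\in V$ put $P_v=\sum_{f\in E,\,s(f)=v}S_fS_f^*$; these are mutually orthogonal nonzero projections and $S_e^*S_e=P_{t(e)}$. Let $\Sigma_G=\{S_e^*,S_e\mid e\in E\}$ (a set of $2|E|$ symbols). For a word $X=(X_1,\dots,X_{2n})$ in $\Sigma_G$ put $\pi_G(X)=X_1\cdots X_{2n}\in\mathcal{O}_{A^G}$. Let $\Phi_G$ replace each symbol $S_e$ (resp. $S_e^*$) by the canonical isometry indexed by $e$ (resp. its adjoint) in the Cuntz algebra $\mathcal{O}_{|E|}$ generated by isometries $\{\hat S_e\}_{e\in E}$ with $\hat S_e^*\hat S_e=1$, $\sum_e\hat S_e\hat S_e^*=1$. For $n\ge1$, $B_n^G$ is the set of words $X$ of length $2n$ in $\Sigma_G$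 with $\pi_G(X)\neq0$ in $\mathcal{O}_{A^G}$ and $\Phi_G(X_1)\cdots\Phi_G(X_{2n})=1$ in $\mathcal{O}_{|E|}$. For each $X\in B_n^G$ there is a unique vertex $v(X)$ with $\pi_G(X)=P_{v(X)}$. Set $B_n^G[e]=\{X\in B_n^G\mid (S_e^*,X_1,\dots,X_{2n},S_e)\in B_{n+1}^G\}$ and $B_n^G(u)=\{X\in B_n^G\mid v(X)=u\}$. For $n\ge 1$: $c_n^G=|B_n^G|$, $c_n^G[e]=|B_n^G[e]|$, $c_n^G(u)=|B_n^G(u)|$; and $c_0^G=|V|$, $c_0^G[e]=c_0^G(u)=1$. **$G$-Dyck paths and $d_n^G$.** $G^*$ is the transposed graph of $G$; the edge $e^*$ of $G^*$ is $e$ reversed, so $s(e^* )=t(e)$, $t(e^* )=s(e)$. A Dyck path of length $2n$ is a sequence $\gamma=(\gamma_1,\dots,\gamma_{2n})$ of vectors $(1,1)$ and $(1,-1)$ such that the broken line starting at the origin stays in the upper half plane $y\ge0$ and ends on the $x$-axis. If $\gamma_i=(1,1)$, its partner is the unique $\gamma_{i+k}=(1,-1)$ such that $(\gamma_{i+1},\dots,\gamma_{i+k-1})$ is a (possibly empty) Dyck path. A $G$-Dyck path of length $2n$ is a Dyck path of length $2n$ whose vectors are labeled so that: (1) vectors $(1,1)$ are labeled by $e^*$, $e\in E$; (2) vectors $(1,-1)$ are labeled by $e\in E$; (3) a vector $(1,1)$ labeled $e^*$ may immediately follow a vector $(1,1)$ labeled $f^*$ only if $t(f^* )=s(e^* )$;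 (4) a vector $(1,1)$ labeled $e^*$ may immediately follow a vector $(1,-1)$ labeled $f$ only if $t(f)=s(e^* )$; (5) a vector $(1,-1)$ labeled $e$ may immediately follow a vector $(1,1)$ labeled $f^*$ only if $e=f$; (6) the partner of a vector $(1,1)$ labeled $e^*$ is labeled $e$. Let $D_n^G$ be the set of $G$-Dyck paths of length $2n$, $r(\gamma)\in E$ the label of the last vector of $\gamma$, $D_n^G[e]=\{\gamma\in D_n^G\mid (e^*,\gamma_1,\dots,\gamma_{2n},e)\in D_{n+1}^G\}$, $D_n^G(u)=\{\gamma\in D_n^G\mid t(r(\gamma))=u\}$. For $n\ge1$: $d_n^G=|D_n^G|$, $d_n^G[e]=|D_n^G[e]|$, $d_n^G(u)=|D_n^G(u)|$; and $d_0^G=|V|$, $d_0^G[e]=d_0^G(u)=1$. *)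

(* Defs.v *)
From HB Require Import structures.
From mathcomp Require Import all_boot all_order all_algebra.
From mathcomp Require Import complex.
From mathcomp Require Import reals.
Set Implicit Arguments.
Unset Strict Implicit.
Unset Printing Implicit Defensive.
Import Order.TTheory GRing.Theory Num.Theory.
Local Open Scope ring_scope.

(** * Unital complex C*-algebras

    The norm is a field of the structure rather than an inherited
    [completeNormedModType]: in the MathComp hierarchy a semiring with a norm is
    forced to be a [numDomainType], so the two structures cannot be joined.
    MathComp algebras satisfy 1 != 0, so the zero algebra is excluded. *)

Definition cauchy_for (R : realType) (A : zmodType) (N : A -> R) (u : nat -> A)
    : Prop :=
  forall eps : R, 0 < eps ->
    exists k, forall m n, (k <= m)%N -> (k <= n)%N -> N (u m - u n) < eps.

Definition cvg_for (R : realType) (A : zmodType) (N : A -> R) (u : nat -> A)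
    (l : A) : Prop :=
  forall eps : R, 0 < eps ->
    exists k, forall n, (k <= n)%N -> N (u n - l) < eps.

HB.mixin Record isCStarAlgebra (R : realType) A of GRing.Algebra R[i] A := {
  cnorm : A -> R ;
  cnorm_eq0 : forall x, cnorm x = 0 -> x = 0 ;
  cnormD_le : forall x y, cnorm (x + y) <= cnorm x + cnorm y ;
  cnormZ : forall (a : R[i]) x, cnorm (a *: x) = ComplexField.Normc.normc a * cnorm x ;
  cnormM_le : forall x y, cnorm (x * y) <= cnorm x * cnorm y ;
  cnorm_complete : forall u : nat -> A,
    cauchy_for cnorm u -> exists l, cvg_for cnorm u l ;
  star : A -> A ;
  starK : involutive star ;
  starD : {morph star : x y / x + y} ;
  starZ : forall (a : R[i]) x, star (a *: x) = a^* *: star x ;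
  starM : forall x y, star (x * y) = star y * star x ;
  cnorm_starM : forall x, cnorm (star x * x) = cnorm x ^+ 2
}.

#[short(type="cstarAlgType")]
HB.structure Definition CStarAlgebra (R : realType) :=
  {A of GRing.Algebra R[i] A & isCStarAlgebra R A}.

(** A is the smallest norm-closed unital *-subalgebra of A containing the
    family S. *)
Definition cstar_generated (R : realType) (A : cstarAlgType R) (I : Type)
    (S : I -> A) : Prop :=
  forall P : A -> Prop,
    (forall (u : nat -> A) l, (forall n, P (u n)) -> cvg_for cnorm u l -> P l) ->
    (forall i, P (S i)) -> P 1 ->
    (forall x y, P x -> P y -> P (x + y)) ->
    (forall (a : R[i]) x, P x -> P (a *: x)) ->
    (forall x y, P x -> P y -> P (x * y)) ->
    (forall x, P x -> P (star x)) ->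
    forall x, P x.

(** (A, S) is the universal unital C*-algebra generated by a family indexed by
    I subject to the relations rel. *)
Definition is_universal_cstar (R : realType) (I : Type)
    (rel : forall B : cstarAlgType R, (I -> B) -> Prop)
    (A : cstarAlgType R) (S : I -> A) : Prop :=
  [/\ rel A S,
      cstar_generated S &
      forall (B : cstarAlgType R) (T : I -> B), rel B T ->
        exists f : {lrmorphism A -> B},
          (forall x, f (star x) = star (f x)) /\ (forall i, f (S i) = T i)].

Definition partial_isometry (R : realType) (A : cstarAlgType R) (s : A) : Prop :=
  s * star s * s = s.

Definition cuntz_krieger_relations (R : realType) (E : finType) (M : rel E)
    (A : cstarAlgType R) (S : E -> A) : Prop :=
  [/\ forall e, partial_isometry (S e),
      \sum_f S f * star (S f) = 1 &
      forall e, star (S e) * S e = \sum_f (M e f)%:R *: (S f * star (S f))].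

Definition cuntz_relations (R : realType) (E : finType)
    (A : cstarAlgType R) (S : E -> A) : Prop :=
  (forall e, star (S e) * S e = 1) /\ \sum_e S e * star (S e) = 1.

Definition is_cuntz_krieger_algebra (R : realType) (E : finType) (M : rel E)
    (A : cstarAlgType R) (S : E -> A) : Prop :=
  is_universal_cstar (@cuntz_krieger_relations R E M) S.

Definition is_cuntz_algebra (R : realType) (E : finType)
    (A : cstarAlgType R) (S : E -> A) : Prop :=
  is_universal_cstar (@cuntz_relations R E) S.

(** * Finite directed graphs, possibly with loops and multiple edges *)

Record digraph : Type := Digraph {
  vertex : finType ;
  edge : finType ;
  source : edge -> vertex ;
  target : edge -> vertex
}.

Definition edge_adj (G : digraph) : rel (edge G) :=
  fun e f => target e == source f.

Definition transpose (G : digraph) : digraph :=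
  Digraph (@target G) (@source G).

Definition rev_edge (G : digraph) (e : edge G) : edge (transpose G) := e.

(** * G-Catalan numbers *)

(** In the alphabet Sigma_G, [inl e] is the symbol S_e^* and [inr e] is the
    symbol S_e. *)
Notation symbol G := (edge G + edge G)%type.

Section Catalan.
Variables (R : realType) (G : digraph).

Definition word_value (A : cstarAlgType R) (S : edge G -> A)
    (X : seq (symbol G)) : A :=
  \prod_(x <- X) match x with inl e => star (S e) | inr e => S e end.

Definition vertex_proj (A : cstarAlgType R) (S : edge G -> A) (v : vertex G) : A :=
  \sum_(f | source f == v) S f * star (S f).

(** S generates the Cuntz-Krieger algebra and Sh the Cuntz algebra. *)
Variables (O : cstarAlgType R) (S : edge G -> O).
Variables (Oh : cstarAlgType R) (Sh : edge G -> Oh).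

Definition Bset (n : nat) : {set (n.*2).-tuple (symbol G)} :=
  [set X : (n.*2).-tuple (symbol G) | (word_value S X != 0) && (word_value Sh X == 1)].

Definition Bset_edge (n : nat) (e : edge G) : {set (n.*2).-tuple (symbol G)} :=
  [set X in Bset n |
    ([tuple of inl e :: rcons X (inr e)] : (n.+1.*2).-tuple _) \in Bset n.+1].

(** v(X) = u means that u is the vertex whose projection is the value of X. *)
Definition Bset_vertex (n : nat) (u : vertex G) : {set (n.*2).-tuple (symbol G)} :=
  [set X in Bset n | word_value S X == vertex_proj S u].

Definition catalan (n : nat) : nat :=
  if n is 0%N then #|vertex G| else #|Bset n|.

Definition catalan_edge (n : nat) (e : edge G) : nat :=
  if n is 0%N then 1%N else #|Bset_edge n e|.

Definition catalan_vertex (n : nat) (u : vertex G) : nat :=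
  if n is 0%N then 1%N else #|Bset_vertex n u|.

End Catalan.

(** * Dyck paths *)

(** In a path, [true] is the vector (1,1) and [false] is the vector (1,-1). *)
Definition height (w : seq bool) : int := \sum_(b <- w) (if b then 1 else -1).

Definition is_dyck (w : seq bool) : bool :=
  [forall k : 'I_(size w).+1, 0 <= height (take k w)] && (height w == 0).

(** Position j holds the partner of the up-vector at position i. *)
Definition partner (w : seq bool) (i j : nat) : bool :=
  [&& (i < j < size w)%N, nth false w i, ~~ nth true w j
    & is_dyck (take (j - i.+1) (drop i.+1 w))].

(** * G-Dyck paths *)

(** [inl e'] is a vector (1,1) labelled by the edge e' of the transposed graph,
    [inr e] is a vector (1,-1) labelled by the edge e of G. *)
Notation step G := (edge (transpose G) + edge G)%type.

Section GDyck.
Variable G : digraph.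

Definition is_up (x : step G) : bool := if x is inl _ then true else false.

Definition may_follow (x y : step G) : bool :=
  match x, y with
  | inl f', inl e' => target f' == source e'
  | inr f, inl e' => target f == source e'
  | inl f', inr e => f' == rev_edge e
  | inr _, inr _ => true
  end.

Definition partners_match (k : nat) (w : k.-tuple (step G)) : bool :=
  [forall e : edge G, forall i : 'I_k, forall j : 'I_k,
    (tnth w i == inl (rev_edge e)) && partner (map is_up w) i j
      ==> (tnth w j == inr e)].

Definition Dset (n : nat) : {set (n.*2).-tuple (step G)} :=
  [set w : (n.*2).-tuple (step G) | [&& is_dyck (map is_up w), sorted may_follow w & partners_match w]].

Definition Dset_edge (n : nat) (e : edge G) : {set (n.*2).-tuple (step G)} :=
  [set w in Dset n |
    ([tuple of inl (rev_edge e) :: rcons w (inr e)] : (n.+1.*2).-tuple _)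
      \in Dset n.+1].

(** The label of the last vector, which in a nonempty Dyck path is (1,-1). *)
Definition last_label (w : seq (step G)) : option (edge G) :=
  if rev w is inr e :: _ then Some e else None.

Definition Dset_vertex (n : nat) (u : vertex G) : {set (n.*2).-tuple (step G)} :=
  [set w in Dset n | omap (@target G) (last_label w) == Some u].

Definition dyck (n : nat) : nat :=
  if n is 0%N then #|vertex G| else #|Dset n|.

Definition dyck_edge (n : nat) (e : edge G) : nat :=
  if n is 0%N then 1%N else #|Dset_edge n e|.

Definition dyck_vertex (n : nat) (u : vertex G) : nat :=
  if n is 0%N then 1%N else #|Dset_vertex n u|.

End GDyck.

(* Main.v *)
(** A word in the symbols S_e^*, S_e has value 1 in the Cuntz algebra exactly
    when it reduces to the empty word under S_e^* S_e -> 1, i.e. when it is a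
    Dyck word whose partners carry the same label.  The value of such a word in
    the Cuntz-Krieger algebra is then P_(t e), where S_e^* is its first symbol,
    if consecutive labels satisfy the G-Dyck path conditions, and 0 otherwise.
    So B_n^G and D_n^G are the same set of words.

    Two facts about C*-algebras are needed.  First, projections with sum 1 are
    mutually orthogonal, which rests on: if d is self-adjoint and
    |1 + d|, |1 - d| <= 1, then d = 0.  Second, every P_v is nonzero; by
    universality it suffices to find one Cuntz-Krieger family with this
    property, and we build it from the given Cuntz algebra: a corner of the
    latter contains two isometries with range projections summing to 1. *)

Require Import Defs.
From HB Require Import structures.
From mathcomp Require Import all_boot all_order all_algebra.
From mathcomp Require Import complex.
From mathcomp Require Import reals.
From mathcomp Require Import ring lra zify.
Set Implicit Arguments.
Unset Strict Implicit.
Unset Printing Implicit Defensive.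
Import Order.TTheory GRing.Theory Num.Theory.
Local Open Scope ring_scope.

(** * Norm and involution in a C*-algebra *)

Section CStarBasics.
Variables (R : realType) (A : cstarAlgType R).
Implicit Types (x y d p : A).

Lemma cnorm0 : cnorm (0 : A) = 0.
Proof.
by rewrite -(scale0r (0 : A)) cnormZ ComplexField.Normc.normc0 mul0r.
Qed.

Lemma cnormMn x n : cnorm (x *+ n) = cnorm x *+ n.
Proof.
by rewrite -scaler_nat cnormZ normcMn ComplexField.Normc.normc1 mulr_natl.
Qed.

Lemma cnormN x : cnorm (- x) = cnorm x.
Proof.
by rewrite -scaleN1r cnormZ normcN ComplexField.Normc.normc1 mul1r.
Qed.

Lemma cnorm_ge0 x : 0 <= cnorm x.
Proof.
have := cnormD_le x (- x); rewrite subrr cnorm0 cnormN -mulr2n.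
by rewrite pmulrn_lge0.
Qed.

Lemma cnormB_le x y : cnorm (x - y) <= cnorm x + cnorm y.
Proof. by rewrite -(cnormN y) cnormD_le. Qed.

Lemma cnorm_sum_le (I : Type) (r : seq I) (P : pred I) (F : I -> A) :
  cnorm (\sum_(i <- r | P i) F i) <= \sum_(i <- r | P i) cnorm (F i).
Proof.
elim/big_rec2: _ => [|i y x _ IH]; first by rewrite cnorm0.
by apply: le_trans (cnormD_le _ _) _; rewrite lerD2l.
Qed.

Lemma star0 : star (0 : A) = 0.
Proof. by apply: (addrI (star 0)); rewrite -starD !addr0. Qed.

Lemma starN x : star (- x) = - star x.
Proof. by apply: (addrI (star x)); rewrite -starD !subrr star0. Qed.

Lemma starB x y : star (x - y) = star x - star y.
Proof. by rewrite starD starN. Qed.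

Lemma star1 : star (1 : A) = 1.
Proof. by rewrite -[LHS]mulr1 -{2}(starK 1) -starM mulr1 starK. Qed.

Lemma star_sum (I : Type) (r : seq I) (P : pred I) (F : I -> A) :
  star (\sum_(i <- r | P i) F i) = \sum_(i <- r | P i) star (F i).
Proof. exact: (big_morph _ starD star0). Qed.

Lemma starMn x n : star (x *+ n) = star x *+ n.
Proof. by elim: n => [|n IH]; rewrite ?star0 // !mulrS starD IH. Qed.

Lemma starX x n : star (x ^+ n) = star x ^+ n.
Proof. by elim: n => [|n IH]; rewrite ?star1 // exprS exprSr starM IH. Qed.

Lemma star_mul_eq0 x : star x * x = 0 -> x = 0.
Proof.
move=> xx; apply: cnorm_eq0; apply/eqP.
by have := expf_eq0 (cnorm x) 2; rewrite -cnorm_starM xx cnorm0 eqxx.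
Qed.

Lemma cnorm_proj_le1 p : star p = p -> p * p = p -> cnorm p <= 1.
Proof.
move=> sp pp; have := cnorm_starM p; rewrite sp pp => pn.
have := cnorm_ge0 p; rewrite le_eqVlt => /predU1P[<-|p0]; first exact: ler01.
by rewrite -(ler_pM2l p0) mulr1 -expr2 -pn.
Qed.

Lemma cnorm_half x y z : x + y = z *+ 2 ->
  cnorm x <= 1 -> cnorm y <= 1 -> cnorm z <= 1.
Proof.
move=> xyz x1 y1; rewrite -(ler_pMn2r (n := 2)) // -cnormMn -xyz.
by apply: le_trans (cnormD_le _ _) _; rewrite mulr2n lerD.
Qed.

Lemma cnormM_le1 x y : cnorm x <= 1 -> cnorm y <= 1 -> cnorm (x * y) <= 1.
Proof.
move=> x1 y1; apply: le_trans (cnormM_le _ _) _.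
by rewrite mulr_ile1 ?cnorm_ge0.
Qed.

Lemma cnormX_le1 x n : cnorm x <= 1 -> cnorm (x ^+ n.+1) <= 1.
Proof.
by move=> x1; elim: n => // n IH; rewrite exprS cnormM_le1.
Qed.

(** The unit is the midpoint of [1 + d] and [1 - d], both in the unit ball; [d = 0] expresses its
    extremality there. *)
Definition contractive_pair d :=
  [/\ star d = d, cnorm (1 + d) <= 1 & cnorm (1 - d) <= 1].

(* Identities between polynomials in one element of A are obtained from [ring]
   in the commutative ring [{poly R[i]}]. *)
Lemma alg_poly_eq x (f g : {poly R[i]}) :
  f = g -> horner_alg x f = horner_alg x g.
Proof. by move=> ->. Qed.

Lemma horner_algE x :
  (horner_alg x 1 = 1) *
  (forall p q : {poly R[i]},
    (horner_alg x (p + q) = horner_alg x p + horner_alg x q) *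
    (horner_alg x (p * q) = horner_alg x p * horner_alg x q)) *
  (forall (p : {poly R[i]}) n,
    (horner_alg x (p *+ n) = horner_alg x p *+ n) *
    (horner_alg x (p ^+ n) = horner_alg x p ^+ n)) *
  (forall (a : R[i]) (p : {poly R[i]}),
    horner_alg x (a *: p) = a *: horner_alg x p) *
  (forall p : {poly R[i]}, horner_alg x (- p) = - horner_alg x p) *
  (horner_alg x 'X = x).
Proof.
split; last exact: horner_algX.
split; last exact: rmorphN.
split; last by move=> a p; rewrite linearZ_LR; exact: mulr_algl.
split; last by move=> p n; split; [exact: rmorphMn | exact: rmorphXn].
split=> [|p q]; first exact: rmorph1.
by split; [exact: rmorphD | exact: rmorphM].
Qed.

(* Take e = (3d + d^3) / 2.  Then 1 + e is the average of (1 + d)^3 and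
   1 - 3d^2, and 1 - 3d^2 is the average of (1 + id)^3 and (1 - id)^3, where
   |1 + id|^2 = |1 + d^2| <= 1. *)
Lemma contractive_pair_cube d : contractive_pair d ->
  exists2 e, contractive_pair e & cnorm d *+ 4 <= cnorm e *+ 3.
Proof.
case=> sd dp dm.
have star_i : star (1 + 'i *: d) = 1 - 'i *: d.
  by rewrite starD star1 starZ conjCi sd scaleNr.
have star_mi : star (1 - 'i *: d) = 1 + 'i *: d by rewrite -star_i starK.
have i2 : 'i * 'i = -1 :> R[i] by rewrite -expr2 sqrCi.
(* Stated for both square roots of -1, to bound 1 + id and 1 - id alike. *)
have dd_i (c : R[i]) : c * c = -1 -> 1 + d * d = (1 - c *: d) * (1 + c *: d).
  move=> c2.
  have := @alg_poly_eq d (1 + 'X * 'X) ((1 - c *: 'X) * (1 + c *: 'X)).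
  rewrite !horner_algE.
  apply; rewrite -!mul_polyC.
  transitivity (1 - (c * c)%:P * 'X * 'X : {poly R[i]}); last first.
    by rewrite polyCM; ring.
  by rewrite c2; ring.
have d21 : cnorm (1 + d * d) <= 1.
  apply: cnorm_half (cnormX_le1 1 dp) (cnormX_le1 1 dm).
  have := @alg_poly_eq d ((1 + 'X) ^+ 2 + (1 - 'X) ^+ 2) ((1 + 'X * 'X) *+ 2).
  rewrite !horner_algE.
  by apply; ring.
have di : cnorm (1 + 'i *: d) <= 1.
  by rewrite -(@expr_le1 _ 2) ?cnorm_ge0 // -cnorm_starM star_i -dd_i.
have dmi : cnorm (1 - 'i *: d) <= 1.
  rewrite -(@expr_le1 _ 2) ?cnorm_ge0 // -cnorm_starM star_mi.
  by have := dd_i (- 'i); rewrite mulrNN scaleNr opprK => <-.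
have p3 : cnorm (1 + d ^+ 2 *+ 3) <= 1.
  apply: cnorm_half (cnormX_le1 2 dp) (cnormX_le1 2 dm).
  have := @alg_poly_eq d ((1 + 'X) ^+ 3 + (1 - 'X) ^+ 3)
    ((1 + 'X ^+ 2 *+ 3) *+ 2).
  rewrite !horner_algE.
  by apply; ring.
have m3 : cnorm (1 - d ^+ 2 *+ 3) <= 1.
  apply: cnorm_half (cnormX_le1 2 di) (cnormX_le1 2 dmi).
  have := @alg_poly_eq d ((1 + 'i *: 'X) ^+ 3 + (1 - 'i *: 'X) ^+ 3)
    ((1 - 'X ^+ 2 *+ 3) *+ 2).
  rewrite !horner_algE.
  apply; rewrite -!mul_polyC.
  transitivity ((1 + ('i * 'i)%:P * 'X ^+ 2 *+ 3) *+ 2 : {poly R[i]}).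
    by rewrite polyCM; ring.
  by rewrite i2; ring.
pose e : A := 2^-1 *: (d *+ 3 + d ^+ 3).
have h2 : (2 : R[i]) != 0 by rewrite pnatr_eq0.
have e2 : e *+ 2 = d *+ 3 + d ^+ 3.
  by rewrite -scaler_nat /e scalerA mulfV // scale1r.
have se : star e = e.
  by rewrite /e starZ fmorphV rmorph_nat starD starMn starX sd.
exists e; first split=> //.
- apply: cnorm_half (cnormX_le1 2 dp) m3; rewrite mulrnDl e2.
  have := @alg_poly_eq d ((1 + 'X) ^+ 3 + (1 - 'X ^+ 2 *+ 3))
    (1 *+ 2 + ('X *+ 3 + 'X ^+ 3)).
  rewrite !horner_algE.
  by apply; ring.
- apply: cnorm_half (cnormX_le1 2 dm) m3; rewrite mulrnBl e2.
  have := @alg_poly_eq d ((1 - 'X) ^+ 3 + (1 - 'X ^+ 2 *+ 3))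
    (1 *+ 2 - ('X *+ 3 + 'X ^+ 3)).
  rewrite !horner_algE.
  by apply; ring.
(* The elements bounded in [p3] and [m3] differ by 6d^2, so |d^2| <= 1/3 and |d^3| <= |d|/3. Then 2e
   = 3d + d^3 gives 3|d| <= 2|e| + |d|/3. *)
have sq : cnorm (d ^+ 2) *+ 6 <= 2.
  rewrite -cnormMn (_ : _ *+ 6 = (1 + d ^+ 2 *+ 3) - (1 - d ^+ 2 *+ 3)).
    by apply: le_trans (cnormB_le _ _) _; lra.
  by rewrite opprB addrC addrA subrK -mulrnDr.
have cub : cnorm (d ^+ 3) *+ 3 <= cnorm d.
  have := cnormM_le d (d ^+ 2); rewrite -exprS => h.
  have := cnorm_ge0 d; have := cnorm_ge0 (d ^+ 2); nra.
have : cnorm d *+ 3 <= cnorm e *+ 2 + cnorm (d ^+ 3).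
  rewrite -!cnormMn e2; apply: le_trans (cnormB_le _ _).
  by rewrite addrK.
lra.
Qed.

(* Iterating [contractive_pair_cube] would make the norm grow geometrically,
   while it stays below 1. *)
Lemma contractive_pair_eq0 d : contractive_pair d -> d = 0.
Proof.
(* If n|e| <= 3 and 4|d| <= 3|e|, then (n+1)|d| <= 9(n+1)/(4n), which is at most 3 once n >= 3;
   smaller n use |d| <= 1. *)
have bound n : forall d, contractive_pair d -> cnorm d *+ n <= 3.
  elim: n => [|n IH] {}d hd; first by rewrite mulr0n.
  have d1 : cnorm d <= 1.
    case: hd => _ dp dm; rewrite -(cnormN d).
    apply: (@cnorm_half (1 - d) (- (1 + d))); rewrite ?cnormN //.
    by rewrite opprD addrACA subrr add0r mulr2n.
  case: (ltnP n 3) => n3.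
    apply: le_trans (_ : 1 *+ n.+1 <= _); last by rewrite ler_nat.
    by rewrite lerMn2r d1 orbT.
  have [e /IH en de] := contractive_pair_cube hd.
  have d0 := cnorm_ge0 d.
  have n3' : 3 <= n%:R :> R by rewrite (ler_nat _ 3).
  rewrite -mulr_natr in en; rewrite mulrS -(mulr_natr _ n).
  have : cnorm d * 4 <= cnorm e * 3 by rewrite !mulr_natr.
  nra.
move=> hd; apply: cnorm_eq0; apply/eqP; rewrite eq_le cnorm_ge0 andbT leNgt.
apply/negP => d0.
have := archi_boundP (divr_ge0 (ler0n R 3) (ltW d0)).
by rewrite ltr_pdivrMr // -[X in 3 < X]mulrC mulr_natr ltNge bound.
Qed.

End CStarBasics.

(** * Corners of a C*-algebra *)

(** Nonvanishing is bundled because [proj_val] becomes the unit of the corner. *)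
Record projection (R : realType) (A : cstarAlgType R) := Projection {
  proj_val : A;
  star_proj : star proj_val = proj_val;
  proj_idem : proj_val * proj_val = proj_val;
  proj_neq0 : proj_val != 0
}.

Section Corner.
Variables (R : realType) (A : cstarAlgType R) (p : projection A).
Local Notation e := (proj_val p).

Definition corner_pred : {pred A} := fun x => e * x * e == x.

Record corner := Corner { cval : A; cvalP : cval \in corner_pred }.

Lemma corner_predP (x : A) :
  reflect (e * x = x /\ x * e = x) (x \in corner_pred).
Proof.
apply: (iffP eqP) => [<-|[px xp]]; last by rewrite px xp.
by rewrite !mulrA proj_idem -!mulrA proj_idem !mulrA.
Qed.

Lemma corner_submod_closed : submod_closed corner_pred.
Proof.
split=> [|a x y /corner_predP[px xp] /corner_predP[py yp]].
  by apply/corner_predP; rewrite mulr0 mul0r.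
apply/corner_predP; rewrite mulrDr mulrDl -scalerAr -scalerAl.
by rewrite px xp py yp.
Qed.

HB.instance Definition _ := GRing.isSubmodClosed.Build R[i] A corner_pred
  corner_submod_closed.
HB.instance Definition _ := [isSub for cval].
HB.instance Definition _ := [Choice of corner by <:].
HB.instance Definition _ := [SubChoice_isSubLmodule of corner by <:].

Lemma corner_predM : {in corner_pred &, forall x y, x * y \in corner_pred}.
Proof.
move=> x y /corner_predP[px xp] /corner_predP[py yp].
by apply/corner_predP; rewrite mulrA px -mulrA yp.
Qed.

Lemma corner_pred1 : e \in corner_pred.
Proof. by apply/corner_predP; rewrite proj_idem. Qed.

Lemma corner_pred_star x : x \in corner_pred -> star x \in corner_pred.
Proof.
move=> /corner_predP[px xp]; apply/corner_predP; split.
  by rewrite -{1}star_proj -starM xp.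
by rewrite -{1}star_proj -starM px.
Qed.

Definition corner_mul (x y : corner) :=
  Corner (corner_predM (cvalP x) (cvalP y)).
Definition corner_one := Corner corner_pred1.
Definition corner_star (x : corner) := Corner (corner_pred_star (cvalP x)).

Fact corner_mulA : associative corner_mul.
Proof. by move=> x y z; apply: val_inj; rewrite /= mulrA. Qed.
Fact corner_mul1l : left_id corner_one corner_mul.
Proof. by move=> x; apply: val_inj => /=; case/corner_predP: (cvalP x). Qed.
Fact corner_mul1r : right_id corner_one corner_mul.
Proof. by move=> x; apply: val_inj => /=; case/corner_predP: (cvalP x). Qed.
Fact corner_mulDl : left_distributive corner_mul +%R.
Proof. by move=> x y z; apply: val_inj; rewrite /= mulrDl. Qed.
Fact corner_mulDr : right_distributive corner_mul +%R.
Proof. by move=> x y z; apply: val_inj; rewrite /= mulrDr. Qed.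
Fact corner_one_neq0 : corner_one != 0.
Proof. exact: proj_neq0. Qed.

HB.instance Definition _ := GRing.Zmodule_isNzRing.Build corner
  corner_mulA corner_mul1l corner_mul1r corner_mulDl corner_mulDr
  corner_one_neq0.

Fact corner_scaleAl (a : R[i]) (x y : corner) : a *: (x * y) = a *: x * y.
Proof. by apply: val_inj; rewrite /= scalerAl. Qed.
HB.instance Definition _ :=
  GRing.Lmodule_isLalgebra.Build R[i] corner corner_scaleAl.

Fact corner_scaleAr (a : R[i]) (x y : corner) : a *: (x * y) = x * (a *: y).
Proof. by apply: val_inj; rewrite /= scalerAr. Qed.
HB.instance Definition _ :=
  GRing.Lalgebra_isAlgebra.Build R[i] corner corner_scaleAr.

Definition corner_norm (x : corner) := cnorm (cval x).

Fact corner_norm_eq0 x : corner_norm x = 0 -> x = 0.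
Proof. by move=> /cnorm_eq0 x0; apply: val_inj. Qed.
Fact corner_normD_le x y : corner_norm (x + y) <= corner_norm x + corner_norm y.
Proof. exact: cnormD_le. Qed.
Fact corner_normZ (a : R[i]) x :
  corner_norm (a *: x) = ComplexField.Normc.normc a * corner_norm x.
Proof. exact: cnormZ. Qed.
Fact corner_normM_le x y : corner_norm (x * y) <= corner_norm x * corner_norm y.
Proof. exact: cnormM_le. Qed.
Fact corner_starK : involutive corner_star.
Proof. by move=> x; apply: val_inj; rewrite /= starK. Qed.
Fact corner_starD : {morph corner_star : x y / x + y}.
Proof. by move=> x y; apply: val_inj; rewrite /= starD. Qed.
Fact corner_starZ (a : R[i]) x : corner_star (a *: x) = a^* *: corner_star x.
Proof. by apply: val_inj; rewrite /= starZ. Qed.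
Fact corner_starM x y : corner_star (x * y) = corner_star y * corner_star x.
Proof. by apply: val_inj; rewrite /= starM. Qed.
Fact corner_norm_starM x : corner_norm (corner_star x * x) = corner_norm x ^+ 2.
Proof. exact: cnorm_starM. Qed.

(* The corner is closed: pxp = x passes to the limit because
   |plp - l| <= |p(l - u_n)p| + |u_n - l| <= 2 |u_n - l|. *)
Fact corner_norm_complete (u : nat -> corner) :
  cauchy_for corner_norm u -> exists l, cvg_for corner_norm u l.
Proof.
move=> cu; have [|l ul] := @cnorm_complete R A (fun n => cval (u n)).
  by move=> eps /cu.
suff lP : l \in corner_pred by exists (Corner lP) => eps /ul.
have p1 := cnorm_proj_le1 (star_proj p) (proj_idem p).
rewrite unfold_in -subr_eq0; apply/eqP/cnorm_eq0/eqP.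
rewrite eq_le cnorm_ge0 andbT leNgt; apply/negP => n0.
have /ul [k /(_ k (leqnn k)) uk] : 0 < cnorm (e * l * e - l) / 2.
  by rewrite divr_gt0.
have := cnormB_le (cval (u k) - l) (e * (cval (u k) - l) * e).
rewrite mulrBr mulrBl (eqP (cvalP (u k))) opprB addrC subrKA.
have := cnormM_le (e * (cval (u k) - l)) e.
have := cnormM_le e (cval (u k) - l).
have := cnorm_ge0 e; have := cnorm_ge0 (cval (u k) - l).
have := cnorm_ge0 (e * (cval (u k) - l)).
rewrite mulrBr mulrBl (eqP (cvalP (u k))).
nra.
Qed.

HB.instance Definition _ := isCStarAlgebra.Build R corner
  corner_norm_eq0 corner_normD_le corner_normZ corner_normM_le
  corner_norm_complete corner_starK corner_starD corner_starZ corner_starM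
  corner_norm_starM.

Lemma cval_sum (I : Type) (r : seq I) (P : pred I) (F : I -> corner) :
  cval (\sum_(i <- r | P i) F i) = \sum_(i <- r | P i) cval (F i).
Proof. by elim/big_rec2: _ => // i x y _ <-. Qed.

End Corner.

(** * Orthogonality of projections with sum 1 *)

Section Orthogonality.
Variables (R : realType) (A : cstarAlgType R) (I : finType).

(* In the corner [P j A P j], whose unit is [P j], the elements
   [a k = P j * P k * P j] with [k != j] sum to 0 and satisfy |1 - a k| <= 1.
   Averaging over k, both 1 - a i / #|I| and 1 + a i / #|I| have norm at
   most 1, hence a i = 0. *)
Lemma proj_sum1_ortho (P : I -> A) :
  (forall i, star (P i) = P i) -> (forall i, P i * P i = P i) ->
  \sum_i P i = 1 -> forall i j, i != j -> P i * P j = 0.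
Proof.
move=> sP iP sum1 i j ij.
have [->|Pj0] := eqVneq (P j) 0; first by rewrite mulr0.
pose p := Projection (sP j) (iP j) Pj0.
have aP k : P j * P k * P j \in corner_pred p.
  by apply/corner_predP; rewrite /= !mulrA iP -!mulrA iP.
pose a k : corner p := Corner (aP k).
have aj : a j = 1 by apply: val_inj; rewrite /= !iP.
have a_sum : \sum_k a k = 1.
  apply: val_inj; rewrite [LHS]cval_sum /= -mulr_suml -mulr_sumr sum1.
  by rewrite mulr1 iP.
have norm1 : cnorm (1 : corner p) <= 1 by apply: cnorm_proj_le1 (sP j) (iP j).
(* [1 - a k] is the compression of the projection [1 - P k]. *)
have norm_a k : cnorm (1 - a k) <= 1.
  rewrite [cnorm _](_ : _ = cnorm (P j * (1 - P k) * P j)); last first.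
    by rewrite mulrBr mulrBl mulr1 iP.
  have Pj1 := cnorm_proj_le1 (sP j) (iP j).
  apply: cnormM_le1 _ (Pj1); apply: cnormM_le1 (Pj1) _.
  apply: cnorm_proj_le1; first by rewrite starB star1 sP.
  by rewrite mulrBl mul1r mulrBr iP mulr1 subrr subr0.
pose n := #|I|.
have n0 : (0 < n)%N by apply/card_gt0P; exists i.
have le1 (x : corner p) : cnorm (x *+ n) <= n%:R -> cnorm x <= 1.
  by rewrite cnormMn lerMn2r; move: n0; case: (n).
pose d := (n%:R^-1 : R[i]) *: a i.
have dn : d *+ n = a i.
  by rewrite -scaler_nat scalerA mulfV ?scale1r // pnatr_eq0 -lt0n.
have d0 : d = 0.
  apply: contractive_pair_eq0; split.
  - rewrite starZ fmorphV rmorph_nat; congr (_ *: _).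
    by apply: val_inj; rewrite /= !starM !sP mulrA.
  - apply: le1; rewrite mulrnDl dn.
    (* Since [a j = 1] and the [a k] sum to 1, [a i] is minus the sum of the other [a k] with k
       distinct from i and j. So n + [a i] is a sum of n terms of norm at most 1. *)
    pose c k := if (k == i) || (k == j) then 1 else 1 - a k.
    have -> : 1 *+ n + a i = \sum_k c k.
      have -> : 1 *+ n = \sum_(k : I) (1 : corner p) by rewrite sumr_const.
      have -> : \sum_k c k = \sum_(k : I) (1 : corner p)
          - \sum_(k | (k != j) && (k != i)) a k.
        rewrite [X in _ - X]big_mkcond -sumrB; apply: eq_bigr => k _.
        by rewrite /c orbC -negb_or; case: ifP; rewrite ?subr0.
      congr (_ + _); apply/eqP; rewrite -addr_eq0; apply/eqP.
      apply: (addrI (1 : corner p)); rewrite addr0 -[RHS]a_sum.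
      by rewrite [RHS](bigD1 j) //= aj [in RHS](bigD1 i).
    apply: le_trans (cnorm_sum_le _ _ _) _.
    rewrite -sumr_const; apply: ler_sum => k _.
    by rewrite /c; case: ifP.
  - apply: le1; rewrite mulrnBl dn -(prednK n0) mulrSr -addrA.
    apply: le_trans (cnormD_le _ _) _; rewrite -natr1 lerD // cnormMn.
    by rewrite lerMn2r norm1 orbT.
have /(congr1 (@cval _ _ p)) : a i = 0 by rewrite -dn d0 mul0rn.
(* [P j * P i * P j] is [star x * x] for [x = P i * P j]. *)
rewrite /= => PiPj; apply: star_mul_eq0.
by rewrite starM !sP mulrA -[P j * P i * P i]mulrA iP.
Qed.

(** Each [S i] absorbs its range projection, and range projections with sum 1 are orthogonal. *)
Lemma isometries_ortho (S : I -> A) :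
  (forall i, partial_isometry (S i)) -> \sum_i S i * star (S i) = 1 ->
  forall i j, i != j -> star (S i) * S j = 0.
Proof.
move=> pS sum1 i j ij.
have -> : star (S i) * S j
    = star (S i) * ((S i * star (S i)) * (S j * star (S j))) * S j.
  by rewrite -{1}(pS i) -{1}(pS j) !starM starK !mulrA.
rewrite (proj_sum1_ortho (P := fun i => S i * star (S i))) ?mulr0 ?mul0r //.
- by move=> k; rewrite starM starK.
- by move=> k; rewrite mulrA pS.
Qed.

End Orthogonality.

(** * Nonvanishing of the vertex projections *)

Section IsometryFamilies.
Variables (R : realType).

Definition isometry_family (A : cstarAlgType R) (E : eqType) (s : seq E)
    (T : E -> A) : Prop :=
  {in s &, forall e f, star (T e) * T f = (e == f)%:R} /\
  \sum_(e <- s) T e * star (T e) = 1.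

(** Induction on the labels: the new one gets [V true], the others are moved into the complementary
    range by [V false]. *)
Lemma isometry_family_exists (A : cstarAlgType R) (V : bool -> A) :
  isometry_family [:: true; false] V ->
  forall (E : eqType) (s : seq E), uniq s -> s != [::] ->
  exists T : E -> A, isometry_family s T.
Proof.
case=> orthV sumV E; elim=> [//|e s IH] /= /andP[es us] _.
case: s => [|e' s] in es us IH *.
  exists (fun=> 1); split=> [x y|]; last by rewrite big_seq1 star1 mulr1.
  by rewrite !inE => /eqP-> /eqP->; rewrite eqxx star1 mulr1.
have [T [orthT sumT]] := IH us isT.
exists (fun x => if x == e then V true else V false * T x); split.
  move=> x y; rewrite !(in_cons e).
  have [-> _|xe /= xs] := eqVneq x e; have [-> _|ye /= ys] := eqVneq y e.
  - by rewrite orthV ?inE.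
  - by rewrite mulrA orthV ?inE // mul0r.
  - by rewrite starM -mulrA orthV ?inE // mulr0 (negPf xe).
  - by rewrite starM -mulrA (mulrA _ (V false)) orthV ?inE // mul1r orthT.
rewrite big_cons eqxx.
rewrite (eq_big_seq (fun x => V false * (T x * star (T x)) * star (V false))).
  by rewrite -mulr_suml -mulr_sumr sumT mulr1 -sumV big_cons big_seq1.
move=> x xs; have /negPf-> : x != e by apply: contraNneq es => <-.
by rewrite starM !mulrA.
Qed.

(* K-theory forbids a unital copy of O_2 in O_n in general; the corner of
   p = 1 - aa^* has one because [p] = 0 in K_0. *)
Lemma corner_isometry_pair (A : cstarAlgType R) (a b : A) :
  star a * a = 1 -> star b * b = 1 -> star a * b = 0 ->
  exists (p : projection A) (V : bool -> corner p),
    isometry_family [:: true; false] V.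
Proof.
move=> aa bb ab.
have ba : star b * a = 0 by rewrite -[LHS]starK starM starK ab star0.
have aaK x : star a * (a * x) = x by rewrite mulrA aa mul1r.
have bbK x : star b * (b * x) = x by rewrite mulrA bb mul1r.
have abK x : star a * (b * x) = 0 by rewrite mulrA ab mul0r.
have baK x : star b * (a * x) = 0 by rewrite mulrA ba mul0r.
have [e eE] : exists e, e = 1 - a * star a by eexists.
have se : star e = e by rewrite eE starB star1 starM starK.
have ea : e * a = 0 by rewrite eE mulrBl mul1r -mulrA aa mulr1 subrr.
have eb : e * b = b by rewrite eE mulrBl mul1r -mulrA ab mulr0 subr0.
have sae : star a * e = 0 by rewrite -[LHS]starK starM starK se ea star0.
have sbe : star b * e = star b by rewrite -[LHS]starK starM starK se eb.
have ee : e * e = e by rewrite {1}eE mulrBl mul1r -mulrA sae mulr0 subr0.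
have e0 : e != 0.
  apply/eqP => e0; move: eb (oner_neq0 A); rewrite e0 mul0r => b0.
  by rewrite -bb -b0 mulr0 eqxx.
pose p := Projection se ee e0.
have [q qE] : exists q, q = e - b * star b by eexists.
have sq : star q = q by rewrite qE starB se starM starK.
have bq : star b * q = 0 by rewrite qE mulrBr sbe bbK subrr.
have qb : q * b = 0 by rewrite -[LHS]starK starM sq bq star0.
have aq : star a * q = 0 by rewrite qE mulrBr sae abK subrr.
have qa : q * a = 0 by rewrite -[LHS]starK starM sq aq star0.
have eq_ : e * q = q by rewrite eE mulrBl mul1r -mulrA aq mulr0 subr0.
have qe : q * e = q by rewrite -[LHS]starK starM sq se eq_.
have qq : q * q = q by rewrite {1}qE mulrBl -mulrA bq mulr0 subr0 eq_.
(* [b * e] and [W] both have initial projection [e]. Their ranges, b e b^* and b a a^* b^* + q, add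
   up to b b^* + q = e. *)
have [W WE] : exists W, W = b * a * star b + q by eexists.
have sW : star W = b * star a * star b + q.
  by rewrite WE starD sq !starM starK mulrA.
have WP : W \in corner_pred p.
  apply/corner_predP; rewrite /= WE.
  by split; [rewrite mulrDr eq_ !mulrA eb | rewrite mulrDl qe -!mulrA sbe].
have beP : b * e \in corner_pred p.
  by apply/corner_predP; rewrite /= mulrA eb -mulrA ee.
exists p, (fun c => if c then Corner beP else Corner WP); split.
  have VW : star (b * e) * W = 0.
    by rewrite starM se WE mulrDr -!mulrA bq bbK mulr0 addr0 mulrA ea mul0r.
  have WW : star W * W = e.
    rewrite sW WE mulrDl !mulrDr -!mulrA bq !bbK aaK (mulrA q) qb qq.
    by rewrite !mulr0 mul0r addr0 add0r qE addrC subrK.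
  move=> [] [] _ _; apply: val_inj; rewrite /= ?VW ?WW //.
  - by rewrite starM se -mulrA bbK.
  - by rewrite -[LHS]starK starM starK VW star0.
rewrite big_cons big_seq1; apply: val_inj; rewrite /= sW starM se.
rewrite WE mulrDl !mulrDr !mulrA qb -!mulrA bq bbK qq (mulrA e) ee.
rewrite !(mulr0, mul0r) addr0 add0r !mulrA {1}eE.
by rewrite mulrBr mulr1 mulrBl !mulrA addrA subrK qE addrC subrK.
Qed.

End IsometryFamilies.

(** * Cuntz-Krieger families built from two isometries *)

Section CuntzKriegerFamily.
Variables (R : realType) (G : digraph) (A : cstarAlgType R).

(** Each [T e] is cut down so that its initial projection becomes P_(t e) instead of 1. This uses an
    isometry [W v] onto the joint range of the [T e] with e leaving v; then P_v is the range
    projection of [W v], hence nonzero. *)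
Lemma cuntz_krieger_family_exists (V : bool -> A) :
  isometry_family [:: true; false] V ->
  (forall v : vertex G, exists e : edge G, source e = v) ->
  (0 < #|edge G|)%N ->
  exists S : edge G -> A,
    cuntz_krieger_relations (@edge_adj G) S /\
    forall v, vertex_proj S v != 0.
Proof.
move=> hV hout hE.
have [|//|T [orthT sumT]] := isometry_family_exists hV (s := enum (edge G)).
- exact: enum_uniq.
- by rewrite -size_eq0 -cardE -lt0n.
have orth e f : star (T e) * T f = (e == f)%:R.
  by apply: orthT; rewrite mem_enum.
pose out v := [seq e <- enum (edge G) | source e == v].
have us v : uniq (out v) by rewrite filter_uniq ?enum_uniq.
have exU v : exists U : edge G -> A, isometry_family (out v) U.
  apply: (isometry_family_exists hV (us v)).
  have [e ev] := hout v; rewrite -has_filter; apply/hasP.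
  by exists e; rewrite ?mem_enum ?ev ?eqxx.
have [U hU] := fin_all_exists exU.
(* The [U v e] have ranges summing to 1, which makes [W v] an isometry; that they are isometries
   themselves gives its range. *)
pose W v := \sum_(e <- out v) T e * star (U v e).
have WW v : star (W v) * W v = 1.
  have [orthU <-] := hU v.
  rewrite star_sum mulr_suml; apply: eq_big_seq => e eo.
  rewrite mulr_sumr (bigD1_seq e) //=.
  rewrite starM starK -mulrA (mulrA _ (T e)) orth eqxx mul1r.
  rewrite big1 ?addr0 // => f fe.
  by rewrite -mulrA (mulrA _ (T f)) orth eq_sym (negPf fe) mul0r mulr0.
have WsW v : W v * star (W v) = \sum_(e | source e == v) T e * star (T e).
  have [orthU _] := hU v.
  rewrite [RHS](_ : _ = \sum_(e <- out v) T e * star (T e)); last first.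
    by rewrite big_filter big_enum_cond; apply: eq_bigl.
  rewrite {2}/W star_sum mulr_suml.
  apply: eq_big_seq => e eo.
  rewrite mulr_sumr (bigD1_seq e) //=.
  rewrite starM starK -mulrA (mulrA _ (U v e)) orthU // eqxx mul1r.
  rewrite big1_seq ?addr0 // => f /andP[fe fo].
  rewrite starM starK -mulrA (mulrA _ (U v f)) orthU // eq_sym (negPf fe).
  by rewrite mul0r mulr0.
pose S e := T e * star (W (target e)).
have SS e : S e * star (S e) = T e * star (T e).
  by rewrite starM starK -mulrA (mulrA _ (W _)) WW mul1r.
have Pv v : vertex_proj S v = W v * star (W v).
  by rewrite WsW; apply: eq_bigr => e _; rewrite SS.
exists S; split; first split.
- move=> e; rewrite /partial_isometry SS /S -mulrA (mulrA _ (T e)) orth.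
  by rewrite eqxx mul1r.
- rewrite (eq_bigr _ (fun e _ => SS e)).
  by rewrite -sumT big_enum.
- move=> e; rewrite starM starK -mulrA (mulrA _ (T e)) orth eqxx mul1r WsW.
  rewrite big_mkcond; apply: eq_bigr => f _; rewrite SS /edge_adj eq_sym.
  by case: eqP; rewrite ?scale1r ?scale0r.
move=> v; apply/eqP => P0.
have : star (W v) * (W v * star (W v)) * W v = 1.
  by rewrite mulrA WW mul1r WW.
by rewrite -Pv P0 mulr0 mul0r => /esym/eqP; rewrite oner_eq0.
Qed.

End CuntzKriegerFamily.

(** Two distinct edges give two isometries of [Oh] with orthogonal ranges, hence a Cuntz-Krieger
    family in a corner. The morphism given by universality sends P_v to a nonzero projection
    there. *)
Lemma vertex_proj_neq0 (R : realType) (G : digraph)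
    (hout : forall v : vertex G, exists e : edge G, source e = v)
    (hE : (2 <= #|edge G|)%N)
    (O : cstarAlgType R) (S : edge G -> O)
    (hS : is_cuntz_krieger_algebra (@edge_adj G) S)
    (Oh : cstarAlgType R) (Sh : edge G -> Oh) (hSh : cuntz_relations Sh)
    (v : vertex G) : vertex_proj S v != 0.
Proof.
have /card_gt1P[e [f [_ _ ef]]] := hE.
have pSh i : partial_isometry (Sh i).
  by rewrite /partial_isometry -mulrA (proj1 hSh) mulr1.
have [p [V hV]] := corner_isometry_pair (proj1 hSh e) (proj1 hSh f)
  (isometries_ortho pSh (proj2 hSh) ef).
have [T [/(let: And3 _ _ h := hS in h) [g [gstar gS]] T0]] :=
  cuntz_krieger_family_exists hV hout (ltnW hE).
apply: contraNneq (T0 v) => Pv; apply/eqP; rewrite -(rmorph0 g) -Pv.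
by rewrite rmorph_sum; apply: eq_bigr => i _; rewrite rmorphM /= gstar gS.
Qed.

(** * Values of words *)

Section MatchedWords.
Variable E : eqType.
Implicit Types (st : seq E) (w : seq (E + E)).

(* [st] is the stack of labels of the symbols [inl e] still to be closed. *)
Fixpoint matched st w : bool :=
  match w, st with
  | [::], _ => nilp st
  | inl e :: w', _ => matched (e :: st) w'
  | inr e :: w', f :: st' => (e == f) && matched st' w'
  | inr _ :: _, [::] => false
  end.

End MatchedWords.

Section WordValues.
Variables (R : realType) (G : digraph) (A : cstarAlgType R) (S : edge G -> A).
Implicit Types (st : seq (edge G)) (w : seq (symbol G)) (u v : vertex G).

(** The head of [st] is the label opened last, so its adjoint is the rightmost factor. *)
Definition stack_value st : A := star (\prod_(e <- st) S e).

Lemma stack_value_nil : stack_value [::] = 1.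
Proof. by rewrite /stack_value big_nil star1. Qed.

Lemma stack_value_cons e st :
  stack_value (e :: st) = stack_value st * star (S e).
Proof. by rewrite /stack_value big_cons starM. Qed.

Lemma word_value_nil : word_value S [::] = 1.
Proof. exact: big_nil. Qed.

Lemma word_value_cons x w : word_value S (x :: w) =
  (match x with inl e => star (S e) | inr e => S e end) * word_value S w.
Proof. exact: big_cons. Qed.

(** Each symbol S_e meets the top of the stack, and S_f^* S_e is 1 or 0. A leftover S_e^* on the
    right, or S_e on the left, cannot give 1: it would annihilate S_f, or its adjoint, for another
    edge f. *)
Lemma cuntz_word_eq1 st w : cuntz_relations S -> (2 <= #|edge G|)%N ->
  (stack_value st * word_value S w == 1) = matched st w.
Proof.
move=> [SS sumS] hE.
have ortho e f : e != f -> star (S e) * S f = 0.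
  by apply: isometries_ortho => // i; rewrite /partial_isometry -mulrA SS mulr1.
have S0 e : S e != 0.
  by apply/eqP => e0; have /eqP := SS e; rewrite e0 mulr0 eq_sym oner_eq0.
have other (e : edge G) : exists f, f != e.
  have /card_gt1P[a [b [_ _ ab]]] := hE.
  by case: (eqVneq a e) ab => [->|ae] ab; [exists b; rewrite eq_sym | exists a].
elim: w st => [|[e|e] w IH] st /=.
- rewrite word_value_nil mulr1; case: st => [|e st] /=.
    by rewrite stack_value_nil eqxx.
  rewrite stack_value_cons; apply/eqP => h; have [f fe] := other e.
  have := S0 f; rewrite -[S f]mul1r -h -mulrA ortho ?mulr0 ?eqxx //.
  by rewrite eq_sym.
- by rewrite word_value_cons mulrA -stack_value_cons IH.
case: st => [|f st]; rewrite word_value_cons.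
  rewrite stack_value_nil mul1r; apply/eqP => h; have [f fe] := other e.
  have := S0 f; rewrite -[S f]starK -[star (S f)]mulr1 -h mulrA ortho //.
  by rewrite mul0r star0 eqxx.
rewrite stack_value_cons -mulrA (mulrA _ (S e)).
case: (eqVneq e f) => [->|ef] /=; first by rewrite SS mul1r IH.
by rewrite ortho ?mul0r ?mulr0; [rewrite eq_sym oner_eq0 | rewrite eq_sym].
Qed.

(** * Values of matched words in a Cuntz-Krieger family *)

Section CuntzKriegerWords.
Hypothesis ckS : cuntz_krieger_relations (@edge_adj G) S.
Local Notation P := (vertex_proj S).

Lemma ck_ortho e f : e != f -> star (S e) * S f = 0.
Proof. by case: ckS => pS sumS _; apply: isometries_ortho. Qed.

Lemma ck_starK e : S e * (star (S e) * S e) = S e.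
Proof. by case: ckS => pS _ _; rewrite mulrA pS. Qed.

Lemma star_vertex_proj v : star (P v) = P v.
Proof. by rewrite star_sum; apply: eq_bigr => e _; rewrite starM starK. Qed.

Lemma ck_star_mul e : star (S e) * S e = P (target e).
Proof.
case: ckS => _ _ ->; rewrite /vertex_proj [RHS]big_mkcond.
apply: eq_bigr => f _; rewrite /edge_adj eq_sym.
by case: eqP; rewrite ?scale1r ?scale0r.
Qed.

Lemma vertex_proj_mul_S v e : P v * S e = if source e == v then S e else 0.
Proof.
rewrite mulr_suml; case: ifP => ev.
  rewrite (bigD1 e) //= -mulrA ck_starK big1 ?addr0 // => f /andP[_ fe].
  by rewrite -mulrA ck_ortho ?mulr0.
apply: big1 => f fv; rewrite -mulrA ck_ortho ?mulr0 //.
by apply: contraFneq ev => <-.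
Qed.

Lemma vertex_proj_mul u v : P u * P v = if v == u then P u else 0.
Proof.
rewrite mulr_sumr; case: eqP => [->|/eqP vu].
  by apply: eq_bigr => e ev; rewrite mulrA vertex_proj_mul_S ev.
apply: big1 => e /eqP ev.
by rewrite mulrA vertex_proj_mul_S ev (negPf vu) mul0r.
Qed.

Lemma vertex_proj_mul_star v e :
  P v * star (S e) = if target e == v then star (S e) else 0.
Proof.
have <- : P (target e) * star (S e) = star (S e).
  by rewrite -[in RHS](ck_starK e) ck_star_mul starM star_vertex_proj.
rewrite mulrA vertex_proj_mul; case: eqP => [->|_] //.
by rewrite mul0r.
Qed.

Lemma star_mul_vertex_proj e : star (S e) * P (source e) = star (S e).
Proof.
by rewrite -star_vertex_proj -starM vertex_proj_mul_S eqxx.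
Qed.

Lemma vertex_proj_inj u v : P u != 0 -> P u = P v -> u = v.
Proof.
move=> u0 uv; apply/eqP; apply: contraTT u0 => vu; rewrite negbK.
have := vertex_proj_mul v u; rewrite (negPf vu) -uv.
by rewrite vertex_proj_mul eqxx => ->.
Qed.

(* The vertex v with [X_1 ... X_k P v = X_1 ... X_k] when X_k = x. *)
Definition end_vertex (x : symbol G) : vertex G :=
  match x with inl e => source e | inr e => target e end.

(** Read from its head, the stack is a path of G from v to u. *)
Fixpoint stack_chain u st v : bool :=
  if st is e :: st' then (source e == v) && stack_chain u st' (target e)
  else v == u.

(** After S_e^* the label on top is e, so in a matched word the rule for a down-step following an
    up-step holds automatically. *)
Definition top_of_stack (x : symbol G) st : bool :=
  if x is inl e then ohead st == Some e else true.

Lemma ck_word_value u st (x : symbol G) w :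
  stack_chain u st (end_vertex x) -> top_of_stack x st -> matched st w ->
  stack_value st * P (end_vertex x) * word_value S w
    = if path (@may_follow G) x w then P u else 0.
Proof.
elim: w st x => [|[e|e] w IH] st x ch top; rewrite [matched _ _]/=.
- case: st ch top => //= /eqP-> _ _.
  by rewrite stack_value_nil word_value_nil mul1r mulr1.
- move=> mt; rewrite word_value_cons -mulrA (mulrA (P _)) vertex_proj_mul_star.
  have -> : path (@may_follow G) x (inl e :: w)
      = (target e == end_vertex x) && path (@may_follow G) (inl e) w.
    by rewrite /=; congr andb; case: (x) => f; rewrite /= eq_sym.
  case: eqP => [ex|_] /=; last by rewrite mul0r mulr0.
  rewrite -(IH (e :: st)) //=; last by rewrite eqxx ex.
  by rewrite stack_value_cons -!mulrA (mulrA (star _)) star_mul_vertex_proj.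
case: st ch top => [//|f st] /= /andP[/eqP fv ch] top /andP[/eqP ef mt].
move: ef => -> in mt *.
have -> /= : may_follow x (inr f) by case: (x) top => //= g /eqP[->].
rewrite -(IH st) // stack_value_cons word_value_cons -fv.
rewrite -(mulrA _ (star _)) star_mul_vertex_proj -!mulrA (mulrA _ (S f)).
by rewrite ck_star_mul.
Qed.

(** Under the same invariants the last closed label ends at u, which relates the vertex of a word to
    the last label of its path. *)
Lemma ck_word_end_vertex u st (x : symbol G) w :
  stack_chain u st (end_vertex x) -> top_of_stack x st -> matched st w ->
  path (@may_follow G) x w -> exists2 f, last x w = inr f & target f = u.
Proof.
elim: w st x => [|[e|e] w IH] st x ch top; rewrite [matched _ _]/=.
- by case: st ch top => //=; case: x => // f /eqP; exists f.
- move=> mt /= /andP[xe]; apply: (IH (e :: st)) => //=; rewrite eqxx /=.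
  suff -> : target e = end_vertex x by [].
  by case: (x) xe => f /= /eqP.
case: st ch top => [//|f st] /= /andP[/eqP fv ch] top /andP[/eqP ef mt].
by move: ef => -> in mt * => /andP[_]; apply: IH mt.
Qed.

Lemma matched_word_value e w : matched [::] (inl e :: w) ->
  word_value S (inl e :: w) =
    if path (@may_follow G) (inl e) w then P (target e) else 0.
Proof.
move=> mw; rewrite -(@ck_word_value _ [:: e]) //= ?eqxx //.
rewrite stack_value_cons stack_value_nil mul1r star_mul_vertex_proj.
by rewrite word_value_cons.
Qed.

End CuntzKriegerWords.
End WordValues.

(** * G-Dyck paths as words *)

Section DyckWords.

(** Running height as a natural number: a descent from 0 fails. *)
Fixpoint dyck_from (h : nat) (w : seq bool) : bool :=
  match w, h with
  | [::], _ => h == 0%N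
  | true :: w', _ => dyck_from h.+1 w'
  | false :: w', h'.+1 => dyck_from h' w'
  | false :: _, 0 => false
  end.

Lemma height_cons b w : height (b :: w) = (if b then 1 else -1) + height w.
Proof. exact: big_cons. Qed.

Lemma height_nil : height [::] = 0.
Proof. exact: big_nil. Qed.

Lemma dyck_fromP h w :
  ((forall k, 0 <= h%:Z + height (take k w)) /\ h%:Z + height w = 0)
  <-> dyck_from h w.
Proof.
elim: w h => [|b w IH] h.
  rewrite height_nil addr0 /=; split=> [[_ [->]] //|/eqP->].
  by split=> // k; rewrite /= height_nil.
rewrite height_cons; split=> [[ge0 eq0]|].
  case: b ge0 eq0 => ge0 eq0 /=.
    apply/IH; split=> [k|]; last by rewrite -eq0; lia.
    by have := ge0 k.+1; rewrite /= height_cons; lia.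
  case: h ge0 eq0 => [|h] ge0 eq0.
    by have := ge0 1%N; rewrite /= take0 height_cons height_nil; lia.
  apply/IH; split=> [k|]; last by rewrite -eq0; lia.
  by have := ge0 k.+1; rewrite /= height_cons; lia.
case: b => /= [/IH|]; last case: h => // h /IH.
  move=> [ge0 eq0].
  split=> [[|k]|]; rewrite /= ?height_nil ?height_cons; try lia.
  by have := ge0 k; lia.
move=> [ge0 eq0]; split=> [[|k]|]; rewrite /= ?height_nil ?height_cons; try lia.
by have := ge0 k; lia.
Qed.

Lemma is_dyckE w : is_dyck w = dyck_from 0 w.
Proof.
apply/idP/idP => [/andP[/forallP ge0 /eqP h0]|/dyck_fromP[ge0 h0]].
  apply/dyck_fromP; split=> [k|]; rewrite add0r //.
  have [kw|kw] := ltnP k (size w).+1; first exact: (ge0 (Ordinal kw)).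
  by rewrite take_oversize ?h0 // ltnW.
rewrite /is_dyck; apply/andP; split; last by rewrite -h0 add0r.
by apply/forallP => k; have := ge0 k; rewrite add0r.
Qed.

Lemma dyck_from_cat h w1 w2 :
  dyck_from 0 w1 -> dyck_from h (w1 ++ w2) = dyck_from h w2.
Proof.
have gen k : dyck_from k w1 -> dyck_from (k + h) (w1 ++ w2) = dyck_from h w2.
  elim: w1 k => [|[] w1 IH] [|k] //=; first by move/IH.
  - by move/IH.
  - by move/IH.
by move/(gen 0%N).
Qed.

End DyckWords.

(** * Stack matching and labels of partners *)

Section DyckMatching.
Variable E : eqType.
Implicit Types (st : seq E) (w D : seq (E + E)).

Local Notation up := (fun x : E + E => if x is inl _ then true else false).

(* [x] is the partner of [inl e] in [w]. *)
Definition partner_labels w : Prop :=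
  forall pre e D x post, w = pre ++ inl e :: D ++ x :: post ->
    ~~ up x -> dyck_from 0 (map up D) -> x = inr e.

Lemma matched_dyck_from st w : matched st w -> dyck_from (size st) (map up w).
Proof.
elim: w st => [|[e|e] w IH] st /=; first by rewrite nilpE size_eq0.
- by move/IH.
by case: st => [|f st] //= /andP[_ /IH].
Qed.

(** A Dyck factor only opens and closes labels above [st], so the stack is the same after it. *)
Lemma matched_cat_dyck st D w :
  dyck_from 0 (map up D) -> matched st (D ++ w) -> matched st w.
Proof.
have gen st' : dyck_from (size st') (map up D) ->
    matched (st' ++ st) (D ++ w) -> matched st w.
  elim: D st' => [|[e|e] D IH] st' /=; first by case: st'.
  - by move=> /(IH (e :: st')).
  by case: st' => [|f st'] //= d /andP[_]; apply: IH.
exact: (gen [::]).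
Qed.

Lemma matched_suffix st w1 w2 :
  matched st (w1 ++ w2) -> exists st', matched st' w2.
Proof.
elim: w1 st => [|[e|e] w1 IH] st /=; first by exists st.
- exact: IH.
by case: st => [|f st] //= /andP[_]; apply: IH.
Qed.

Lemma matched_partner_labels st w : matched st w -> partner_labels w.
Proof.
move=> mw pre e D x post wE xup dD; rewrite {}wE in mw.
have [st' /= m1] := matched_suffix mw.
have {m1} := matched_cat_dyck dD m1.
by clear mw; case: x xup => //= f _ /andP[/eqP->].
Qed.

(* [open_stack pre st]: the labels of the up-steps of [pre] that have not been
   closed yet are, from right to left, [st]. *)
Inductive open_stack : seq (E + E) -> seq E -> Prop :=
| OpenNil D : dyck_from 0 (map up D) -> open_stack D [::]
| OpenCons pre st e D : open_stack pre st -> dyck_from 0 (map up D) ->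
    open_stack (pre ++ inl e :: D) (e :: st).

Lemma open_stack_cat pre st D :
  open_stack pre st -> dyck_from 0 (map up D) -> open_stack (pre ++ D) st.
Proof.
case=> [D'|pre' st' e D' h] dD' dD.
  by apply: OpenNil; rewrite map_cat dyck_from_cat.
rewrite -catA cat_cons; apply: OpenCons h _.
by rewrite map_cat dyck_from_cat.
Qed.

(** Scanning from the left, [open_stack] records where each pending label was opened. Only a Dyck
    word separates the top one from the next down-step, which is therefore its partner. *)
Lemma partner_labels_matched w : partner_labels w ->
  dyck_from 0 (map up w) -> matched [::] w.
Proof.
move=> lw dw.
have gen pre st w' : w = pre ++ w' -> open_stack pre st ->
    dyck_from (size st) (map up w') -> matched st w'.
  elim: w' pre st => [|[e|e] w' IH] pre st wE op /=.
  - by rewrite nilpE size_eq0.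
  - move=> d; apply: (IH (pre ++ [:: inl e])) => //; first by rewrite -catA.
    exact: OpenCons.
  case: op wE => // pre' {}st f D op dD wE /= d.
  rewrite -catA /= in wE.
  have [->] := lw _ _ _ _ _ wE isT dD; rewrite eqxx /=.
  (* The closed block is again a Dyck word and joins the prefix below it. *)
  apply: (IH (pre' ++ (inl f :: D ++ [:: inr e]))) d.
    by rewrite wE -catA /= -catA.
  apply: open_stack_cat op _.
  by rewrite /= map_cat /=; move: (dyck_from_cat 1 [:: false] dD) => /= ->.
by apply: (gen [::] [::]) => //; apply: OpenNil.
Qed.

Lemma matchedE w :
  matched [::] w <-> dyck_from 0 (map up w) /\ partner_labels w.
Proof.
split=> [mw|[dw lw]]; last exact: partner_labels_matched.
by split; [apply: (matched_dyck_from mw) | apply: matched_partner_labels mw].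
Qed.

End DyckMatching.

(** * G-Dyck paths as matched admissible words *)

Section GDyckWords.
Variable G : digraph.

(** Positions i < j correspond to factorizations with [size pre = i] and [size D = j - i - 1]. *)
Lemma partners_matchP k (w : k.-tuple (step G)) :
  reflect (@partner_labels (edge G) w) (partners_match w).
Proof.
apply: (iffP idP) => [pm pre e D x post wE xup dD | lw].
  have kE : k = (size pre + (size D + (size post).+1).+1)%N.
    by rewrite -(size_tuple w) wE size_cat /= size_cat.
  have ik : (size pre < k)%N by rewrite kE; lia.
  have jk : (size pre + (size D).+1 < k)%N by rewrite kE; lia.
  have wi : tnth w (Ordinal ik) = inl e.
    by rewrite (tnth_nth x) /= wE nth_cat ltnn subnn.
  have wj : tnth w (Ordinal jk) = x.
    rewrite (tnth_nth x) /= wE nth_cat ltnNge leq_addr /= addKn.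
    by rewrite /= nth_cat ltnn subnn.
  move/forallP/(_ e)/forallP/(_ (Ordinal ik))/forallP/(_ (Ordinal jk)): pm.
  rewrite wi wj eqxx /= => /implyP imp; apply/eqP/imp.
  rewrite /partner size_map size_tuple; apply/and4P; split.
  - by rewrite jk andbT; lia.
  - by rewrite (nth_map x) ?size_tuple // -(tnth_nth x w (Ordinal ik)) wi.
  - by rewrite (nth_map x) ?size_tuple // -(tnth_nth x w (Ordinal jk)) wj.
  rewrite is_dyckE wE -map_drop -map_take.
  rewrite (_ : drop _ _ = D ++ x :: post); last first.
    by rewrite -cat_rcons drop_size_cat // size_rcons.
  by rewrite take_size_cat //; lia.
apply/forallP => e; apply/forallP => i; apply/forallP => j.
apply/implyP => /andP[/eqP wi /and4P[]].
rewrite size_map size_tuple => /andP[ij _] _ xup.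
rewrite is_dyckE -map_drop -map_take => dD.
apply/eqP; apply: (lw (take i w) _ _ _ (drop j.+1 w)) dD.
- rewrite -[LHS](cat_take_drop i); congr (_ ++ _).
  rewrite (drop_nth (tnth w i)) ?size_tuple // -tnth_nth wi; congr (_ :: _).
  rewrite -[LHS](cat_take_drop (j - i.+1)); congr (_ ++ _).
  rewrite drop_drop subnK // (drop_nth (tnth w j)) ?size_tuple //.
  by rewrite -tnth_nth.
move: xup; rewrite (nth_map (tnth w j)) ?size_tuple //.
by rewrite -tnth_nth.
Qed.

Lemma mem_Dset n (w : (n.*2).-tuple (step G)) : (w \in Dset G n) =
  matched [::] (w : seq (symbol G)) && sorted (@may_follow G) w.
Proof.
rewrite inE is_dyckE andbCA andbC; congr andb.
apply/idP/idP => [/andP[dw /partners_matchP lw]|/matchedE[dw lw]].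
  exact/matchedE.
by apply/andP; split=> //; apply/partners_matchP.
Qed.

End GDyckWords.

(** * Equality of the G-Dyck and G-Catalan numbers *)

Theorem theorem4p4 (R : realType) (G : digraph)
    (hin : forall v : vertex G, exists e : edge G, target e = v)
    (hout : forall v : vertex G, exists e : edge G, source e = v)
    (hE : (2 <= #|edge G|)%N)
    (O : cstarAlgType R) (S : edge G -> O)
    (hS : is_cuntz_krieger_algebra (@edge_adj G) S)
    (Oh : cstarAlgType R) (Sh : edge G -> Oh)
    (hSh : is_cuntz_algebra Sh)
    (n : nat) :
  (forall e : edge G, dyck_edge n e = catalan_edge S Sh n e) /\
  (forall u : vertex G, dyck_vertex n u = catalan_vertex S Sh n u) /\
  dyck G n = catalan S Sh n.
Proof.
case: hSh => ckSh _ _; have ckS := let: And3 h _ _ := hS in h.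
have P0 v := vertex_proj_neq0 hout hE hS ckSh v.
(* Cuntz value 1 means matched. A nonempty matched word then has Cuntz-Krieger value P_v or 0
   according to admissibility, and P_v is nonzero. *)
have memB k (X : (k.*2).-tuple (symbol G)) : (X \in Bset S Sh k) =
    matched [::] X && sorted (@may_follow G) X.
  rewrite inE andbC -(cuntz_word_eq1 [::] _ ckSh hE) stack_value_nil mul1r.
  have [X1|//] := eqVneq.
  have : matched [::] X.
    by rewrite -(cuntz_word_eq1 _ _ ckSh hE) stack_value_nil mul1r X1.
  case: (X : seq _) => [|[e|//] w] mX /=.
    by rewrite word_value_nil oner_eq0.
  by rewrite (matched_word_value ckS mX); case: ifP; rewrite ?P0 ?eqxx.
have DB k : Dset G k = Bset S Sh k.
  by apply/setP => X; rewrite memB mem_Dset.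
(* For n = 0 both sides are the same constants by convention. *)
case: n => [|n] //; split; [|split].
- move=> e; congr #|pred_of_set _|; apply/setP => X.
  by rewrite [LHS]inE [RHS]inE !DB.
- move=> u; rewrite /dyck_vertex /catalan_vertex; congr #|pred_of_set _|.
  apply/setP => X; rewrite [LHS]inE [RHS]inE DB memB.
  case mX: (matched _ X); case sX: (sorted _ X) => //=.
  case: X mX sX => [[|[e|//] w]] //= _ mX sX.
  (* The word value is P at the target of the first label, whereas the path is classified by its
     last label; the two targets agree. *)
  have [f lastf fe] :
      exists2 f, last (inl e) w = inr f & target f = @target G e.
    by apply: (@ck_word_end_vertex G _ [:: e]); rewrite //= !eqxx.
  rewrite (matched_word_value ckS mX) sX /last_label -fe.
  rewrite lastI rev_rcons lastf /=; apply/eqP/eqP => [[->] //|].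
  by move/(vertex_proj_inj ckS (P0 _)) => ->.
by rewrite /dyck DB.
Qed.
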